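(* Let $1\le n\in\mathbb{N}$ and let $V$ be a variety of semigroups. Then $V$ is $\gamma_n$-solid if and only if $$x_1\ldots x_{n+1}\approx y_1\ldots y_{n+1}\in IdV,$$ where $x_1,\ldots,x_{n+1},y_1,\ldots,y_{n+1}$ are pairwise distinct variables.
   Context: The type is $\tau=(2)$ with one binary operation symbol $f$. $W_{(2)}(X)$ is the set of terms of this type over a countably infinite alphabet of variables $X=\{x_1,x_2,\ldots\}$ (variables are also denoted by other letters such as $y_1,y_2,\ldots$). A hypersubstitution $\sigma$ of type $(2)$ assigns to $f$ a term $\sigma(f)\in W_{(2)}(\{x_1,x_2\})$; $Hyp(2)$ is the set of all of them. For a term $u$ over $\{x_1,x_2\}$, $S^2(u,t_1,t_2)$ is the term obtained from $u$ by simultaneously substituting $t_1$ for $x_1$ and $t_2$ for $x_2$. Each $\sigma\in Hyp(2)$ induces $\widehat{\sigma}:W_{(2)}(X)\to W_{(2)}(X)$ by $\widehat{\sigma}[w]:=w$ for $w\in X$ and $\widehat{\sigma}[f(t_1,t_2)]:=S^2(\sigma(f),\widehat{\sigma}[t_1],\widehat{\sigma}[t_2])$. For $\sigma\in Hyp(2)$ and $n\in\mathbb{N}=\{0,1,2,\ldots\}$, mappings $\sigma^{\gamma_n}:W_{(2)}(X)\to W_{(2)}(X)$ are defined by: $\sigma^{\gamma_0}:=\widehat{\sigma}$; and for $n\ge 1$, $\sigma^{\gamma_n}(x):=x$ for $x\in X$ and $\sigma^{\gamma_n}(f(t_1,t_2)):=f(\sigma^{\gamma_{n-1}}(t_1),\sigma^{\gamma_{n-1}}(t_2))$.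 A variety of semigroups is a variety of algebras of type $(2)$ satisfying the associative law; $IdV$ is the set of all identities $s\approx t$ (with $s,t\in W_{(2)}(X)$) holding in $V$. $V$ is called $\gamma_n$-solid iff $\sigma^{\gamma_n}(s)\approx\sigma^{\gamma_n}(t)\in IdV$ for all $s\approx t\in IdV$ and all $\sigma\in Hyp(2)$. In semigroup identities the symbol $f$ and brackets are omitted. *)

(* Defs.v *)
From mathcomp Require Import all_boot.
From Stdlib Require ClassicalEpsilon.

Set Implicit Arguments.
Unset Strict Implicit.
Unset Printing Implicit Defensive.

Inductive term (X : Type) : Type :=
| Var of X
| App of term X & term X.

(* W_(2)(X); the countably infinite alphabet is nat. *)
Notation W2 := (term nat).

(* sigma is represented by the term sigma(f); the alphabet {x_1, x_2} is 'I_2,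
   with x_1 = 0 and x_2 = 1. *)
Definition hyp2 : Type := term 'I_2.

Fixpoint tsubst (X Y : Type) (g : X -> term Y) (u : term X) : term Y :=
  match u with
  | Var x => g x
  | App u1 u2 => App (tsubst g u1) (tsubst g u2)
  end.

Definition S2 (X : Type) (u : term 'I_2) (t1 t2 : term X) : term X :=
  tsubst (fun i => tnth [tuple t1; t2] i) u.

Fixpoint hat (sigma : hyp2) (t : W2) : W2 :=
  match t with
  | Var x => Var x
  | App t1 t2 => S2 sigma (hat sigma t1) (hat sigma t2)
  end.

Fixpoint gamma (n : nat) (sigma : hyp2) (t : W2) : W2 :=
  match n with
  | 0 => hat sigma t
  | m.+1 =>
      match t with
      | Var x => Var x
      | App t1 t2 => App (gamma m sigma t1) (gamma m sigma t2)
      end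
  end.

(* Algebras of type (2) have a nonempty carrier, as usual in universal
   algebra. *)
Record algebra : Type := Algebra {
  carrier :> Type;
  op : carrier -> carrier -> carrier;
  carrier_inhabited : inhabited carrier
}.

Definition is_hom (A B : algebra) (h : A -> B) : Prop :=
  forall a b : A, h (op a b) = op (h a) (h b).

Lemma prod_inhabited (I : Type) (A : I -> algebra) :
  inhabited (forall i, A i).
Proof.
exact: (inhabits (fun i =>
  ClassicalEpsilon.epsilon (carrier_inhabited (A i)) (fun _ => True))).
Qed.

Definition prod_algebra (I : Type) (A : I -> algebra) : algebra :=
  @Algebra (forall i, A i) (fun a b i => op (a i) (b i)) (prod_inhabited A).

(* Classes closed under homomorphic images, subalgebras and direct products.
   Subalgebras are taken up to isomorphism, as injective homomorphisms.  The
   index type I may be empty, so that a variety contains a one-element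
   algebra. *)
Record variety (V : algebra -> Prop) : Prop := Variety {
  variety_H : forall (A B : algebra) (h : A -> B),
    is_hom h -> (forall b, exists a, h a = b) -> V A -> V B;
  variety_S : forall (A B : algebra) (h : B -> A),
    is_hom h -> injective h -> V A -> V B;
  variety_P : forall (I : Type) (A : I -> algebra),
    (forall i, V (A i)) -> V (prod_algebra A)
}.

Definition semigroup_variety (V : algebra -> Prop) : Prop :=
  variety V /\ forall A : algebra, V A -> associative (@op A).

Fixpoint eval (A : algebra) (v : nat -> A) (t : W2) : A :=
  match t with
  | Var x => v x
  | App t1 t2 => op (eval v t1) (eval v t2)
  end.

Definition satisfies (A : algebra) (s t : W2) : Prop :=
  forall v : nat -> A, eval v s = eval v t.

Definition Id (V : algebra -> Prop) (s t : W2) : Prop :=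
  forall A : algebra, V A -> satisfies A s t.

Definition gamma_solid (n : nat) (V : algebra -> Prop) : Prop :=
  forall s t : W2, Id V s t ->
    forall sigma : hyp2, Id V (gamma n sigma s) (gamma n sigma t).

(* The word w_1 ... w_(n+1), bracketed to the left; in a variety of semigroups
   the choice of the bracketing is immaterial. *)
Definition word (n : nat) (w : n.+1.-tuple nat) : W2 :=
  foldl (fun t z => App t (Var z)) (Var (thead w)) (behead w).

(* Main.v *)
Require Import Defs.
From mathcomp Require Import all_boot.

Set Implicit Arguments.
Unset Strict Implicit.
Unset Printing Implicit Defensive.

(** Left to right: if the [n] operation symbols of depth less than [n] form a
    path in [s], then [gamma n sigma] keeps them and only collapses the subterm
    at the end of the path, to its first or its last letter when sigma(f) is
    x_1 or x_2.  Two bracketings of [p a b c q], where [p] and [q] have n - 1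
    letters in total, with the bottom subterm [a b] and [b c] respectively, thus
    yield [p a c q = p a b q] and [p b c q = p a c q].  So each letter of a word
    of length n + 1 can be changed at will.

    Right to left: all words of length greater than [n] are equal in [V], and
    [gamma n sigma] either fixes a term or maps a term of length greater than
    [n] to another one, because a path of [n] symbols has [n + 1] subterms
    hanging off it. Hence [gamma n sigma t = t] holds in [V] for all [t]. *)

Fixpoint leaves (X : Type) (t : term X) : seq X :=
  match t with
  | Var x => [:: x]
  | App t1 t2 => leaves t1 ++ leaves t2
  end.

Definition lapp (X : Type) (t : term X) (l : seq X) : term X :=
  foldl (fun u z => App u (Var z)) t l.

Definition rapp (X : Type) (l : seq X) (t : term X) : term X :=
  foldr (fun z u => App (Var z) u) t l.

(* Junk value [Var 0] on the empty list. *)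
Definition comb (l : seq nat) : W2 := lapp (Var (head 0 l)) (behead l).

Lemma word_comb (n : nat) (x : n.+1.-tuple nat) : word x = comb x.
Proof. by case/tupleP: x => a l; rewrite /word theadE. Qed.

Lemma leaves_lapp (X : Type) (t : term X) (l : seq X) :
  leaves (lapp t l) = leaves t ++ l.
Proof.
by elim: l t => [|z l IH] t /=; rewrite ?cats0 // IH -catA.
Qed.

Lemma leaves_rapp (X : Type) (l : seq X) (t : term X) :
  leaves (rapp l t) = l ++ leaves t.
Proof. by elim: l => //= z l ->. Qed.

Lemma size_leaves_gt0 (X : Type) (t : term X) : 0 < size (leaves t).
Proof. by elim: t => //= t1 IH1 t2 _; rewrite size_cat addn_gt0 IH1. Qed.

Lemma gamma_lapp (m : nat) (sigma : hyp2) (t : W2) (l : seq nat) :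
  gamma (size l + m) sigma (lapp t l) = lapp (gamma m sigma t) l.
Proof.
elim/last_ind: l => [|l z IH] //.
rewrite size_rcons /lapp !foldl_rcons /= -/(lapp _ _) IH.
by case: (size l + m).
Qed.

Lemma gamma_rapp (m : nat) (sigma : hyp2) (l : seq nat) (t : W2) :
  gamma (size l + m) sigma (rapp l t) = rapp l (gamma m sigma t).
Proof. by elim: l => //= z l ->; case: (size l + m). Qed.

(** If a subterm is moved, it and its image are long by induction, and the sibling adds at least one
    leaf on both sides. *)
Lemma gamma_fix_or_long (n : nat) (sigma : hyp2) (t : W2) :
  gamma n sigma t = t \/
  n < size (leaves t) /\ n < size (leaves (gamma n sigma t)).
Proof.
elim: n t => [|n IH] t; first by right; rewrite !size_leaves_gt0.
case: t => [z|t1 t2] /=; first by left.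
rewrite !size_cat.
have g0 := @size_leaves_gt0 nat.
case: (IH t1) => [e1|[a1 b1]].
  case: (IH t2) => [e2|[a2 b2]]; first by left; rewrite e1 e2.
  by right; rewrite -![n.+2]add1n !leq_add ?g0.
by right; rewrite -![n.+2]addn1 !leq_add ?g0.
Qed.

Lemma eval_lapp (A : algebra) (v : nat -> A) (t : W2) (l : seq nat) :
  eval v (lapp t l) = foldl (@op A) (eval v t) (map v l).
Proof. by elim: l t => //= z l IH t; rewrite IH. Qed.

Lemma eval_comb_leaves (A : algebra) (v : nat -> A) (t : W2) :
  associative (@op A) -> eval v (comb (leaves t)) = eval v t.
Proof.
move=> opA.
have foldl_op a b s : foldl (@op A) (op a b) s = op a (foldl (@op A) b s).
  by elim: s b => //= c s IH b; rewrite -opA IH.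
elim: t => //= t1 <- t2 <-.
rewrite /comb !eval_lapp.
case: (leaves t1) (size_leaves_gt0 t1) => //= a s1 _.
case: (leaves t2) (size_leaves_gt0 t2) => //= b s2 _.
by rewrite map_cat foldl_cat /= foldl_op.
Qed.

Section IdSemigroup.

Variable V : algebra -> Prop.
Hypothesis opA : forall A : algebra, V A -> associative (@op A).

Lemma Id_trans (s t u : W2) : Id V s t -> Id V t u -> Id V s u.
Proof. by move=> st tu A VA v; rewrite st // tu. Qed.

Lemma Id_leaves (s t : W2) :
  Id V s t <-> Id V (comb (leaves s)) (comb (leaves t)).
Proof.
split=> st A VA v; have := st A VA v.
  by rewrite !(eval_comb_leaves v _ (opA VA)).
by rewrite !(eval_comb_leaves v _ (opA VA)).
Qed.

Lemma gamma_solid_collapse (n : nat) (sigma : hyp2) (p q : seq nat)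
    (a b c : nat) :
  gamma_solid n V -> (size p + size q).+1 = n ->
  Id V (comb (p ++ leaves (S2 sigma (Var a) (Var b)) ++ c :: q))
       (comb (p ++ a :: leaves (S2 sigma (Var b) (Var c)) ++ q)).
Proof.
move=> solV sz.
pose s := rapp p (lapp (App (Var a) (Var b)) (c :: q)).
pose t := rapp (rcons p a) (lapp (App (Var b) (Var c)) q).
have st : Id V s t.
  by rewrite Id_leaves !leaves_rapp !leaves_lapp cat_rcons.
have := solV _ _ st sigma; rewrite Id_leaves.
have -> : gamma n sigma s = rapp p (lapp (S2 sigma (Var a) (Var b)) (c :: q)).
  (* The context consumes exactly [n] levels, so [gamma 0], that is [hat], acts on the bottom
     subterm. *)
  have -> : n = size p + (size (c :: q) + 0) by rewrite addn0 addnS.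
  by rewrite gamma_rapp gamma_lapp.
have -> : gamma n sigma t = rapp (rcons p a) (lapp (S2 sigma (Var b) (Var c)) q).
  have -> : n = size (rcons p a) + (size q + 0) by rewrite addn0 size_rcons.
  by rewrite gamma_rapp gamma_lapp.
by rewrite !leaves_rapp !leaves_lapp cat_rcons.
Qed.

Lemma gamma_solid_replace (n : nat) (p q : seq nat) (a b : nat) :
  0 < n -> gamma_solid n V -> size p + size q = n ->
  Id V (comb (p ++ a :: q)) (comb (p ++ b :: q)).
Proof.
move=> n0 solV; case: q => [|c q].
  case/lastP: p => [|p c]; first by move=> n_eq0; rewrite -n_eq0 in n0.
  rewrite size_rcons addn0 => sz.
  (* The last letter changes by means of its left neighbour [c], which exists as [0 < n]: with
     sigma(f) = x_1, [p c a = p c b]. *)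
  have := @gamma_solid_collapse n (Var (inord 0)) p [::] c b a solV.
  by rewrite !cat_rcons addn0 /S2 /= !(tnth_nth (Var 0)) !inordK //; apply.
rewrite /= addnS => sz.
(* Otherwise the right neighbour [c] serves: with sigma(f) = x_2, [p a c q = p b c q]. *)
have := @gamma_solid_collapse n (Var (inord 1)) p q b a c solV sz.
by rewrite /S2 /= !(tnth_nth (Var 0)) !inordK.
Qed.

(** Letters are replaced from left to right; [p] collects those already done. *)
Lemma gamma_solid_comb (n : nat) (p l l' : seq nat) :
  0 < n -> gamma_solid n V -> size l = size l' -> size p + size l = n.+1 ->
  Id V (comb (p ++ l)) (comb (p ++ l')).
Proof.
move=> n0 solV; elim: l l' p => [|a l IH] [|b l'] p //= [szl].
rewrite addnS => -[sz].
apply: Id_trans (gamma_solid_replace a b n0 solV sz) _.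
by rewrite -!cat_rcons; apply: IH => //; rewrite size_rcons addSn sz.
Qed.

End IdSemigroup.

Lemma Id_word_foldl (n : nat) (V : algebra -> Prop) (x y : n.+1.-tuple nat)
    (A : algebra) (a b : A) (l r : seq A) :
  uniq (x ++ y) -> Id V (word x) (word y) -> V A ->
  size l = n -> size r = n -> foldl (@op A) a l = foldl (@op A) b r.
Proof.
move=> uxy xy VA szl szr.
(* As the variables are distinct, one assignment can send [x] to [a :: l] and [y] to [b :: r]; any
   other variable gets the default [a]. *)
pose v z := nth a ((a :: l) ++ (b :: r)) (index z (x ++ y)).
have mapv : map v (x ++ y) = (a :: l) ++ (b :: r).
  apply: (@eq_from_nth _ a) => [|i].
    by rewrite size_map !size_cat !size_tuple /= szl szr.
  by rewrite size_map => lti; rewrite (nth_map 0) // /v index_uniq.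
have szx : size (map v x) = size (a :: l) by rewrite size_map size_tuple /= szl.
rewrite map_cat in mapv.
have mx := congr1 (take (size (a :: l))) mapv.
have my := congr1 (drop (size (a :: l))) mapv.
rewrite !take_size_cat // in mx; rewrite !drop_size_cat // in my.
have := xy A VA v; rewrite !word_comb /comb !eval_lapp /=.
case: (tval x) mx => //= x0 x' [-> ->].
by case: (tval y) my => //= y0 y' [-> ->].
Qed.

Theorem theorem4 (n : nat) (hn : 1 <= n) (V : algebra -> Prop)
    (hV : semigroup_variety V)
    (x y : n.+1.-tuple nat) (hxy : uniq (x ++ y)) :
  gamma_solid n V <-> Id V (word x) (word y).
Proof.
case: hV => _ opA; split=> [solV | xy].
  rewrite !word_comb.
  by apply: (@gamma_solid_comb V opA n [::]) => //; rewrite !size_tuple.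
have long (A : algebra) (v : nat -> A) (t u : W2) : V A ->
    n < size (leaves t) -> n < size (leaves u) -> eval v t = eval v u.
  move=> VA.
  rewrite -(eval_comb_leaves v t (opA A VA)) -(eval_comb_leaves v u (opA A VA)).
  rewrite /comb !eval_lapp.
  have split_last (s : seq nat) (a : A) : n < size s ->
      exists c r, size r = n /\
        foldl (@op A) a (map v (behead s)) = foldl (@op A) c r.
    (* The surplus letters are multiplied into the initial factor [c], so that a product of exactly
       [n + 1] elements remains. *)
    move=> sz; pose k := size (behead s) - n; pose m := map v (behead s).
    exists (foldl (@op A) a (take k m)), (drop k m); split.
      by rewrite size_drop size_map subKn // size_behead -ltnS (ltn_predK sz).
    by rewrite -foldl_cat cat_take_drop.
  move=> /split_last - /(_ (v (head 0 (leaves t)))) [c [r [szr ->]]].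
  move=> /split_last - /(_ (v (head 0 (leaves u)))) [d [r' [szr' ->]]].
  exact: (Id_word_foldl c d hxy xy VA szr szr').
have gamma_id sigma t : Id V (gamma n sigma t) t.
  move=> A VA v; case: (gamma_fix_or_long n sigma t) => [-> // | [lt lg]].
  exact: long.
by move=> s t st sigma A VA v; rewrite !gamma_id // st.
Qed.
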